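(* Let $A$ be an infinite unital $C^*$-algebra having a system of matrix units $\{e_{i,j}\}_{i,j=1}^n$. If $e_{1,1}$ is equivalent to $1$, then $\mathbb{M}_n(A)$ is $*$-isomorphic to $A$.
   Context: A system of matrix units $\{e_{i,j}\}_{i,j=1}^n$ of a unital $C^*$-algebra $A$ is a subset of $A$ with $e_{i,j}e_{j,k} = e_{i,k}$, $e_{i,j}e_{k,l} = 0$ if $j \neq k$, $e_{i,j}^* = e_{j,i}$, and $\sum_{i=1}^n e_{i,i} = 1$. Equivalence of projections is Murray–von Neumann equivalence in $A$: $e_{1,1}$ is equivalent to $1$ if there is $v \in A$ with $v^*v = e_{1,1}$ and $vv^* = 1$. $\mathbb{M}_n(A)$ is the $C^*$-algebra of $n \times n$ matrices over $A$. *)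

(* Defs.v *)
From HB Require Import structures.
From mathcomp Require Import all_boot all_order all_algebra.
From mathcomp Require Import all_classical all_reals all_analysis.
From mathcomp Require Export complex.

Set Implicit Arguments.
Unset Strict Implicit.
Unset Printing Implicit Defensive.

Import GRing.Theory Num.Theory.
Import numFieldNormedType.Exports.

Local Open Scope classical_set_scope.
Local Open Scope ring_scope.

(** Unital *-algebras and C*-algebras are defined over an arbitrary
    [C : numClosedFieldType]; the complex ones are obtained with
    [C := R[i]] for [R : realType].  [a^*] is the conjugate of the scalar [a].
    As usual for normed modules over such a [C], norms take their (real,
    nonnegative) values in [C]. *)

HB.mixin Record hasStar (C : numClosedFieldType) A of GRing.Algebra C A := {
  star : A -> A;
  starK : involutive star;
  starD : {morph star : x y / x + y};
  starZ : forall (a : C) (x : A), star (a *: x) = a^* *: star x;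
  starM : forall x y : A, star (x * y) = star y * star x
}.

#[short(type="starAlgType")]
HB.structure Definition StarAlgebra (C : numClosedFieldType) :=
  {A of GRing.Algebra C A & hasStar C A}.

(** Hierarchy-Builder cannot join [GRing.Algebra] with the library's normed
    modules: the join would sit below [Num.NumDomain], which is already declared
    in MathComp.  So the norm is a separate operation, and the library's
    normed-module structure it induces is put on the alias [normed_of A]. *)
HB.mixin Record StarAlgebra_hasCStarNorm (C : numClosedFieldType) A
    of StarAlgebra C A := {
  cnorm : A -> C;
  cnormD : forall x y : A, cnorm (x + y) <= cnorm x + cnorm y;
  cnormZ : forall (a : C) (x : A), cnorm (a *: x) = `|a| * cnorm x;
  cnorm0_eq0 : forall x : A, cnorm x = 0 -> x = 0;
  cnormM : forall x y : A, cnorm (x * y) <= cnorm x * cnorm y;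
  cnorm_star : forall x : A, cnorm (star x * x) = cnorm x ^+ 2
}.

#[short(type="preCStarAlgType")]
HB.structure Definition PreCStarAlgebra (C : numClosedFieldType) :=
  {A of StarAlgebra C A & StarAlgebra_hasCStarNorm C A}.

Definition normed_of {C : numClosedFieldType} (A : preCStarAlgType C) : Type :=
  A.

HB.instance Definition _ (C : numClosedFieldType) (A : preCStarAlgType C) :=
  GRing.Lmodule.on (normed_of A).

HB.instance Definition _ (C : numClosedFieldType) (A : preCStarAlgType C) :=
  Lmodule_isNormed.Build C (normed_of A)
    (@cnormD C A) (@cnormZ C A) (@cnorm0_eq0 C A).

HB.mixin Record PreCStarAlgebra_isComplete (C : numClosedFieldType) A
    of PreCStarAlgebra C A := {
  cstar_complete : forall F : set_system (normed_of A),
    ProperFilter F -> cauchy F -> cvg F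
}.

#[short(type="cstarAlgType")]
HB.structure Definition CStarAlgebra (C : numClosedFieldType) :=
  {A of PreCStarAlgebra C A & PreCStarAlgebra_isComplete C A}.

HB.instance Definition _ (C : numClosedFieldType) (A : cstarAlgType C) :=
  Uniform_isComplete.Build (normed_of A) (@cstar_complete C A).

Section Projections.
Context {C : numClosedFieldType} {A : starAlgType C}.
Implicit Types p q : A.

Definition projection p := star p = p /\ p * p = p.

Definition mvn_equiv p q := exists v : A, star v * v = p /\ v * star v = q.

Definition subprojection q p := p * q = q.

Definition infinite_projection p :=
  exists q, [/\ projection q, subprojection q p, q <> p & mvn_equiv p q].

End Projections.

Definition infinite_algebra {C : numClosedFieldType} (A : starAlgType C) :=
  infinite_projection (1 : A).

Record matrix_units {C : numClosedFieldType} {A : starAlgType C} {n : nat}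
    (e : 'I_n -> 'I_n -> A) : Prop := MatrixUnits {
  mxunitM : forall i j k, e i j * e j k = e i k;
  mxunitM0 : forall i j k l, j != k -> e i j * e k l = 0;
  mxunit_star : forall i j, star (e i j) = e j i;
  mxunit_sum : \sum_i e i i = 1
}.

(** A *-isomorphism is a purely algebraic notion: between C*-algebras it is
    automatically isometric, and a *-algebra has at most one complete C*-norm. *)
Definition star_isomorphic {C : numClosedFieldType} (A B : starAlgType C) :=
  exists f : {lrmorphism A -> B},
    bijective f /\ (forall x, f (star x) = star (f x)).

(** The *-algebra of square matrices over [A].  An alias of ['M[A]_n] is needed
    because MathComp makes ['M[A]_n] a module over [A], whereas here scalars
    are taken in [C] and act entrywise.  Rings with [1 != 0] require the size
    to be a successor. *)
Definition matrix_alg {C : numClosedFieldType} (A : starAlgType C) (n : nat) :=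
  'M[A]_n.

Section MatrixStarAlgebra.
Context {C : numClosedFieldType} {A : starAlgType C} {n : nat}.
Implicit Types (M N : matrix_alg A n.+1) (a b : C).

HB.instance Definition _ :=
  GRing.NzRing.copy (matrix_alg A n.+1) 'M[A]_n.+1.

Definition matrix_alg_scale a M : matrix_alg A n.+1 :=
  \matrix_(i, j) (a *: (M i j)).

Definition matrix_alg_star M : matrix_alg A n.+1 :=
  \matrix_(i, j) star (M j i).

Fact matrix_alg_scaleA a b M :
  matrix_alg_scale a (matrix_alg_scale b M) = matrix_alg_scale (a * b) M.
Proof. by apply/matrixP => i j; rewrite !mxE scalerA. Qed.

Fact matrix_alg_scale1 : left_id 1 matrix_alg_scale.
Proof. by move=> M; apply/matrixP => i j; rewrite !mxE scale1r. Qed.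

Fact matrix_alg_scaleDr : right_distributive matrix_alg_scale +%R.
Proof. by move=> a M N; apply/matrixP => i j; rewrite !mxE scalerDr. Qed.

Fact matrix_alg_scaleDl M :
  {morph matrix_alg_scale^~ M : a b / a + b}.
Proof. by move=> a b; apply/matrixP => i j; rewrite !mxE scalerDl. Qed.

HB.instance Definition _ :=
  GRing.Zmodule_isLmodule.Build C (matrix_alg A n.+1)
    matrix_alg_scaleA matrix_alg_scale1 matrix_alg_scaleDr matrix_alg_scaleDl.

Fact matrix_alg_scaleAl a M N : a *: (M * N) = a *: M * N.
Proof.
apply/matrixP => i j; rewrite !mxE scaler_sumr.
by apply: eq_bigr => k _; rewrite !mxE scalerAl.
Qed.

HB.instance Definition _ :=
  GRing.Lmodule_isLalgebra.Build C (matrix_alg A n.+1) matrix_alg_scaleAl.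

Fact matrix_alg_scaleAr a M N : a *: (M * N) = M * (a *: N).
Proof.
apply/matrixP => i j; rewrite !mxE scaler_sumr.
by apply: eq_bigr => k _; rewrite !mxE scalerAr.
Qed.

HB.instance Definition _ :=
  GRing.Lalgebra_isAlgebra.Build C (matrix_alg A n.+1) matrix_alg_scaleAr.

Fact matrix_alg_starK : involutive matrix_alg_star.
Proof. by move=> M; apply/matrixP => i j; rewrite !mxE starK. Qed.

Fact matrix_alg_starD : {morph matrix_alg_star : M N / M + N}.
Proof. by move=> M N; apply/matrixP => i j; rewrite !mxE starD. Qed.

Fact matrix_alg_starZ a M :
  matrix_alg_star (a *: M) = a^* *: matrix_alg_star M.
Proof. by apply/matrixP => i j; rewrite !mxE starZ. Qed.

Fact matrix_alg_starM M N :
  matrix_alg_star (M * N) = matrix_alg_star N * matrix_alg_star M.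
Proof.
have star0 : star (0 : A) = 0.
  by apply: (@addrI _ (star (0 : A))); rewrite -starD !addr0.
apply/matrixP => i j; rewrite !mxE (big_morph star (@starD C A) star0).
by apply: eq_bigr => k _; rewrite !mxE starM.
Qed.

HB.instance Definition _ :=
  hasStar.Build C (matrix_alg A n.+1)
    matrix_alg_starK matrix_alg_starD matrix_alg_starZ matrix_alg_starM.

End MatrixStarAlgebra.

(* Main.v *)
(** If [star v * v = e_00] and [v * star v = 1], the elements
    [s_i = e_i0 * star v] are isometries with orthogonal ranges [e_ii] summing
    to [1].  Compression by such a family, [x |-> (star s_i * x * s_j)_ij], is a
    *-isomorphism from [A] onto the matrices over [A], with inverse
    [M |-> \sum_ij s_i * M_ij * star s_j]. *)
Require Import Defs.
From HB Require Import structures.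
From mathcomp Require Import all_boot all_order all_algebra.
From mathcomp Require Import all_classical all_reals all_analysis.

Import GRing.Theory Num.Theory.
Local Open Scope ring_scope.

(** The inverse of a bijective morphism is again one; it commutes with [star] because [g] does and
    is injective. This reverses the compression map, which starts from the algebra. *)
Lemma star_isomorphic_sym (C : numClosedFieldType) (A B : starAlgType C) :
  star_isomorphic A B -> star_isomorphic B A.
Proof.
case=> g [[f gK fK] g_star].
pose fz := GRing.isZmodMorphism.Build B A f (can2_zmod_morphism gK fK).
pose fm := GRing.isMonoidMorphism.Build B A f (can2_monoid_morphism gK fK).
pose fs := GRing.isScalable.Build C B A *:%R f (can2_scalable gK fK).
pose f' : {lrmorphism B -> A} := HB.pack f fz fm fs.
exists f'; split; first by exists g.
by move=> x; apply: (can_inj gK); rewrite g_star !fK.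
Qed.

Section CuntzFamily.
Context {C : numClosedFieldType} {A : starAlgType C} {n : nat}.
Variable s : 'I_n.+1 -> A.
Hypothesis s_orthonormal : forall i j, star (s i) * s j = (i == j)%:R.
Hypothesis s_sum : \sum_i s i * star (s i) = 1.

Definition compress (x : A) : matrix_alg A n.+1 :=
  \matrix_(i, j) (star (s i) * x * s j).

Definition assemble (M : matrix_alg A n.+1) : A :=
  \sum_i \sum_j s i * M i j * star (s j).

(** Writing [x] as [1 * x * 1] and expanding both units by [s_sum] gives exactly the double sum. *)
Lemma compressK : cancel compress assemble.
Proof.
move=> x; rewrite -[RHS]mulr1 -[RHS]mul1r -[in RHS]s_sum mulr_suml.
apply: eq_bigr => i _; rewrite !mulr_sumr; apply: eq_bigr => j _.
by rewrite mxE !mulrA.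
Qed.

Lemma assembleK : cancel assemble compress.
Proof.
move=> M; apply/matrixP => i j; rewrite mxE /assemble mulr_sumr mulr_suml.
(* Rows [k != i] vanish since [star (s i) * s k = 0]; then columns [l != j] since
   [star (s l) * s j = 0]. *)
rewrite (bigD1 i) //= [X in _ + X]big1 => [|k ki]; last first.
  rewrite mulr_sumr mulr_suml big1 // => l _.
  by rewrite !mulrA s_orthonormal eq_sym (negPf ki) !mul0r.
rewrite addr0 mulr_sumr mulr_suml (bigD1 j) //= big1 => [|l lj]; last first.
  by rewrite -!mulrA s_orthonormal (negPf lj) !mulr0.
by rewrite addr0 !mulrA s_orthonormal eqxx mul1r -mulrA s_orthonormal eqxx mulr1.
Qed.

Lemma compress_zmod_morphism : zmod_morphism compress.
Proof. by move=> x y; apply/matrixP => i j; rewrite !mxE mulrBr mulrBl. Qed.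

Lemma compress_monoid_morphism : monoid_morphism compress.
Proof.
split=> [|x y]; apply/matrixP => i j.
  by rewrite !mxE mulr1 s_orthonormal.
(* The unit inserted between [x] and [y], expanded by [s_sum], supplies the inner index of the
   matrix product. *)
rewrite !mxE -[X in _ * (X * y)]mulr1 -s_sum mulr_sumr mulr_suml.
rewrite mulr_sumr mulr_suml.
by apply: eq_bigr => k _; rewrite !mxE !mulrA.
Qed.

Lemma compress_scalable : scalable compress.
Proof.
by move=> a x; apply/matrixP => i j; rewrite !mxE -scalerAr -scalerAl.
Qed.

Lemma compress_star x : compress (star x) = star (compress x).
Proof. by apply/matrixP => i j; rewrite !mxE !starM starK mulrA. Qed.

Lemma star_isomorphic_compress : star_isomorphic A (matrix_alg A n.+1).
Proof.
pose gz := GRing.isZmodMorphism.Build A (matrix_alg A n.+1) compress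
  compress_zmod_morphism.
pose gm := GRing.isMonoidMorphism.Build A (matrix_alg A n.+1) compress
  compress_monoid_morphism.
pose gs := GRing.isScalable.Build C A (matrix_alg A n.+1) *:%R compress
  compress_scalable.
pose g : {lrmorphism A -> matrix_alg A n.+1} := HB.pack compress gz gm gs.
exists g; split; last exact: compress_star.
by exists assemble; [exact: compressK | exact: assembleK].
Qed.

End CuntzFamily.

Theorem proposition3p2 (R : realType) (A : cstarAlgType R[i]) (n : nat)
    (e : 'I_n.+1 -> 'I_n.+1 -> A) :
  infinite_algebra A ->
  matrix_units e ->
  mvn_equiv (e ord0 ord0) 1 ->
  star_isomorphic (matrix_alg A n.+1) A.
Proof.
move=> _ [eM eM0 e_star e_sum] [v [vv1 vv2]].
apply: star_isomorphic_sym.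
apply: (star_isomorphic_compress (fun i => e i ord0 * star v)) => [i j|].
  rewrite starM starK e_star mulrA -(mulrA v).
  case: eqVneq => [<-|ij]; last by rewrite eM0 // mulr0 mul0r.
  (* Diagonal case: [v * e_00 * star v = (v * star v) * (v * star v) = 1]. *)
  by rewrite eM -vv1 mulrA vv2 mul1r vv2.
(* Termwise, [e_i0 * (star v * v) * e_0i = e_i0 * e_00 * e_0i = e_ii]. *)
rewrite -e_sum; apply: eq_bigr => i _.
by rewrite starM starK e_star mulrA -(mulrA (e i ord0)) vv1 !eM.
Qed.
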